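(* Let $n\ge 1$, let $\epsilon_1\ge 0$ be a non-negative integer and let $\epsilon_2,\dots,\epsilon_{2n}$ be positive integers. Let $$w=\sigma_3^{-\epsilon_1}\sigma_2^{\epsilon_2}\cdots\sigma_3^{-\epsilon_{2n-1}}\sigma_2^{\epsilon_{2n}}$$ be a word in the braid group $\mathbb{B}_4$, and suppose that $q_4(w)$ is a plat presentation of a rational 2-tangle $T$ which is reduced alternating and standard. Put $$A=A_3^{-\epsilon_1}A_2^{\epsilon_2}\cdots A_3^{-\epsilon_{2n-1}}A_2^{\epsilon_{2n}},\qquad A_2=\begin{bmatrix}-a^{-3}&a^{-1}\\ 0&a\end{bmatrix},\qquad A_3=\begin{bmatrix}a^{-1}&0\\ a&-a^{3}\end{bmatrix}^{-1}.$$ Then $$\langle T\rangle=f^T(a)\langle T_0\rangle+g^T(a)\langle T_\infty\rangle,\qquad\text{where } [f^T(a),g^T(a)]^t=A\,[0,1]^t .$$ Moreover, if $K$ is the knot represented by the plat presentation $\overline{q_4(w)}$, then $$\langle K\rangle=f^T(a)-(a^2+a^{-2})\,g^T(a),$$ and therefore $$X_K(a)=(-a^{-3})^{w(K)}\bigl(f^T(a)-(a^2+a^{-2})g^T(a)\bigr),$$ where $w(K)$ is the writhe of $K$ (computed in the diagram $\overline{q_4(w)}$).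
   Context: Braids and plats. A word in $\mathbb{B}_{4}$ is drawn as a braid diagram on 4 vertical strings, read from top to bottom (the first letter is the topmost crossing). The top endpoints lie on the $x$-axis and are numbered $1,\dots,4$ from left to right. $\sigma_i$ is a crossing between the strings in positions $i,i+1$ whose overcrossing strand runs from bottom-left to top-right; $\sigma_i^{-1}$ is the opposite crossing. $q_{4}(w)$ is the 2-tangle diagram in the lower half plane (with endpoints $1,\dots,4$) obtained from the braid $w$ by joining the bottom endpoints in positions $(1,2)$ and $(3,4)$ by trivial arcs. Its plat closure $\overline{q_4(w)}=p_4(w)$ is the link diagram obtained by also joining the top endpoints $1,2$ and $3,4$ by trivial arcs in the upper half plane. A plat presentation is standard if the braid word involves only $\sigma_2,\sigma_3$ (and inverses), not $\sigma_1$. A tangle diagram is reduced alternating if it is alternating and has no self-crossing that can be removed by a Type I Reidemeister move. A rational 2-tangle is a pair of disjoint properly embedded arcs in a 3-ball that are simultaneously isotopic, rel endpoints, into the boundary. Trivial tangles. $T_0$ is the crossingless 2-tangle joining endpoints $2$–$3$ and $1$–$4$; $T_\infty$ is the crossingless 2-tangle joining $1$–$2$ and $3$–$4$. Kauffman bracket. For link diagrams, with values in $\Lambda=\mathbb{Z}[a,a^{-1}]$: $\langle\text{unknot circle}\rangle=1$; $\langle L\sqcup\bigcirc\rangle=k\langle L\rangle$ with $k=-a^2-a^{-2}$, where $\bigcirc$ is a crossingless circle disjoint from the rest of the diagram; and for a crossing, $\langle\sigma_i^{\pm1}\rangle=a^{\pm1}\langle \mathrm{id}\rangle+a^{\mp1}\langle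 U_i\rangle$, where $\mathrm{id}$ replaces the crossing by two vertical strings and $U_i$ replaces it by a cup above a cap (joining the two upper ends to each other and the two lower ends to each other), the rest of the diagram being fixed. For a 2-tangle diagram $T$, $\langle T\rangle=f^T(a)\langle T_0\rangle+g^T(a)\langle T_\infty\rangle$ is the formal $\Lambda$-linear combination obtained by applying these rules until only $T_0,T_\infty$ remain. For a knot $K$ given by a diagram, $\langle K\rangle$ is the bracket of that diagram and $X_K(a)=(-a^{-3})^{w(K)}\langle K\rangle$ is the Kauffman polynomial, where the writhe $w(K)$ is the sum over crossings of the signs ($+1$ for a right-handed crossing, $-1$ for a left-handed one) after orienting $K$. *)

(* Defs.v *)
From HB Require Import structures.
From mathcomp Require Import all_boot all_order all_algebra.
From mathcomp Require Import fraction.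
From mathcomp Require Import all_classical reals topology normedtype.

Set Implicit Arguments.
Unset Strict Implicit.
Unset Printing Implicit Defensive.

Import Order.TTheory GRing.Theory Num.Theory.
Import numFieldNormedType.Exports.
Local Open Scope classical_set_scope.
Local Open Scope ring_scope.

(** * The ring Z[a, a^-1] *)

(* Laurent polynomials, as the fractions p(a) / a^m inside Frac(Z[a]). *)
Definition is_laurent (x : {fraction {poly int}}) : bool :=
  `[< exists (p : {poly int}) (m : nat),
        x = FracField.tofrac p / FracField.tofrac 'X ^+ m >].

Definition laurent : {pred {fraction {poly int}}} := is_laurent.

Fact tofracX_neq0 m : FracField.tofrac ('X : {poly int}) ^+ m != 0.
Proof. by rewrite expf_neq0 // tofrac_eq0 polyX_eq0. Qed.

Fact laurent_subring_closed : subring_closed laurent.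
Proof.
split.
- by apply/asboolP; exists 1, 0%N; rewrite expr0 divr1 rmorph1.
- move=> _ _ /asboolP[p [m ->]] /asboolP[q [k ->]]; apply/asboolP.
  exists (p * 'X ^+ k - q * 'X ^+ m), (m + k)%N.
  rewrite rmorphB !rmorphM !rmorphXn /= exprD -[- (_ / _)]mulNr.
  rewrite addf_div ?tofracX_neq0 //.
  by rewrite mulNr.
- move=> _ _ /asboolP[p [m ->]] /asboolP[q [k ->]]; apply/asboolP.
  by exists (p * q), (m + k)%N; rewrite rmorphM exprD invfM mulrACA.
Qed.

HB.instance Definition _ :=
  GRing.isSubringClosed.Build _ is_laurent laurent_subring_closed.

Record Lambda := MkLambda { lval :> {fraction {poly int}}; _ : lval \in laurent }.

HB.instance Definition _ := [isSub for lval].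
HB.instance Definition _ := [Choice of Lambda by <:].
HB.instance Definition _ := [SubChoice_isSubComNzRing of Lambda by <:].

Definition Lambda_unit : {pred Lambda} := fun x => `[< exists y, y * x == 1 >].

Definition Lambda_inv (x : Lambda) : Lambda :=
  if pselect (exists y, y * x == 1) is left ex then xchoose ex else x.

Fact Lambda_mulVx : {in Lambda_unit, left_inverse 1 Lambda_inv *%R}.
Proof.
move=> x /asboolP ux; rewrite /Lambda_inv; case: pselect => // ex.
exact/eqP/(xchooseP ex).
Qed.

Fact Lambda_unitPl (x y : Lambda) : y * x = 1 -> Lambda_unit x.
Proof. by move=> /eqP yx; apply/asboolP; exists y. Qed.

Fact Lambda_invr_out : {in [predC Lambda_unit], Lambda_inv =1 id}.
Proof.
move=> x /negP nux; rewrite /Lambda_inv; case: pselect => // ex.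
by case: nux; apply/asboolP.
Qed.

HB.instance Definition _ := GRing.ComNzRing_hasMulInverse.Build Lambda
  Lambda_mulVx Lambda_unitPl Lambda_invr_out.

Fact aL_subproof : FracField.tofrac ('X : {poly int}) \in laurent.
Proof. by apply/asboolP; exists 'X, 0%N; rewrite expr0 divr1. Qed.

(* The variable a. *)
Definition aL : Lambda := MkLambda aL_subproof.

(* The value k of a split circle. *)
Definition kL : Lambda := - aL ^+ 2 - aL ^- 2.

(** * Diagrams on four strings *)

(* [Cross i true] is sigma_(i+1), [Cross i false] its inverse and [Hook i] is
   U_(i+1).  String positions are counted from 0. *)
Inductive piece := Cross of 'I_3 & bool | Hook of 'I_3.

Definition piece_pos (p : piece) : 'I_3 :=
  match p with Cross i _ => i | Hook i => i end.

Definition is_cross (p : piece) : bool := if p is Cross _ _ then true else false.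

Definition sgn (e : bool) : int := if e then 1 else -1.

Definition lft (i : 'I_3) : 'I_4 := widen_ord (leqnSn 3) i.
Definition rgt (i : 'I_3) : 'I_4 := lift ord0 i.

Definition touches (i : 'I_3) (x : 'I_4) : bool := (x == lft i) || (x == rgt i).

Definition swapped (i : 'I_3) (x y : 'I_4) : bool :=
  ((x == lft i) && (y == rgt i)) || ((x == rgt i) && (y == lft i)).

Definition plat_arc (x y : 'I_4) : bool :=
  swapped (inord 0) x y || swapped (inord 2) x y.

(* A word w is the diagram q_4(w), read from top to bottom.  Its h-th piece lies
   between the levels h and h + 1; [(h, x)] is the point of the diagram at
   level h on the vertical line x. *)
Definition dpoint (w : seq piece) : finType := ('I_(size w).+1 * 'I_4)%type.

Definition top_point (w : seq piece) (x : 'I_4) : dpoint w := (ord0, x).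

Definition vertical (p : piece) (x y : 'I_4) : bool :=
  (x == y) && ~~ touches (piece_pos p) x.

Definition crossing (p : piece) (x y : 'I_4) : bool :=
  if p is Cross i _ then swapped i x y else false.

Definition through (p : piece) (x y : 'I_4) : bool :=
  vertical p x y || crossing p x y.

Definition turn (p : piece) (x y : 'I_4) : bool :=
  if p is Hook i then swapped i x y else false.

Definition descends (thr : piece -> rel 'I_4) (w : seq piece) (u v : dpoint w) :=
  (v.1 == u.1.+1 :> nat) && thr (nth (Hook ord0) w u.1) u.2 v.2.

(* u and v are at the same level and are joined by the cup of the hook below
   them, by the cap of the hook above them, by a bottom arc of the plat or, in
   the plat closure, by a top arc. *)
Definition turns (closed : bool) (w : seq piece) (u v : dpoint w) :=
  (u.1 == v.1) &&
  [|| (u.1 < size w)%N && turn (nth (Hook ord0) w u.1) u.2 v.2,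
      (0 < u.1)%N && turn (nth (Hook ord0) w u.1.-1) u.2 v.2,
      (u.1 == size w :> nat) && plat_arc u.2 v.2 |
      closed && (u.1 == 0%N :> nat) && plat_arc u.2 v.2].

Definition adjacent (thr : piece -> rel 'I_4) (closed : bool) (w : seq piece) :
    rel (dpoint w) :=
  fun u v => [|| descends thr u v, descends thr v u | turns closed u v].

(* Strings run through crossings along the strands; edges stop at crossings. *)
Definition string_rel (closed : bool) (w : seq piece) : rel (dpoint w) :=
  adjacent through closed (w := w).

Definition edge_rel (closed : bool) (w : seq piece) : rel (dpoint w) :=
  adjacent vertical closed (w := w).

(** * Kauffman bracket *)

(* The crossingless diagrams obtained by smoothing every crossing of w, with
   their coefficients.  Replacing a letter by vertical strings deletes it. *)
Fixpoint states (w : seq piece) : seq (Lambda * seq piece) :=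
  match w with
  | [::] => [:: (1, [::])]
  | Hook i :: w' => [seq (cd.1, Hook i :: cd.2) | cd <- states w']
  | Cross i e :: w' =>
      [seq (aL ^ sgn e * cd.1, cd.2) | cd <- states w'] ++
      [seq (aL ^ (- sgn e) * cd.1, Hook i :: cd.2) | cd <- states w']
  end.

Definition link_components (w : seq piece) : nat :=
  n_comp (string_rel true (w := w)) predT.

(* Closed components of the tangle diagram q_4(w). *)
Definition tangle_circles (w : seq piece) : nat :=
  n_comp (string_rel false (w := w))
    [pred u | [forall x, ~~ connect (string_rel false (w := w)) (top_point w x) u]].

Definition joins (w : seq piece) (x y : nat) : bool :=
  connect (string_rel false (w := w)) (top_point w (inord x)) (top_point w (inord y)).

(* Brackets of tangles live in the free Lambda-module on <T_0>, <T_oo>. *)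
Definition br_T0 : 'cV[Lambda]_2 := delta_mx 0 0.
Definition br_Too : 'cV[Lambda]_2 := delta_mx 1 0.

Definition br_trivial (d : seq piece) : 'cV[Lambda]_2 :=
  if joins d 1 2 && joins d 0 3 then br_T0
  else if joins d 0 1 && joins d 2 3 then br_Too
  else 0 (* does not occur: a crossingless tangle is planar *).

Definition tangle_bracket (w : seq piece) : 'cV[Lambda]_2 :=
  \sum_(cd <- states w) (cd.1 * kL ^+ tangle_circles cd.2) *: br_trivial cd.2.

(* The bracket of the plat closure of q_4(w). *)
Definition link_bracket (w : seq piece) : Lambda :=
  \sum_(cd <- states w) cd.1 * kL ^+ (link_components cd.2).-1.

(** * Knots, orientations and writhe of the plat closure *)

Definition is_knot (w : seq piece) : Prop := link_components w = 1%N.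

Definition above (w : seq piece) (h : 'I_(size w)) : 'I_(size w).+1 :=
  widen_ord (leqnSn _) h.
Definition below (w : seq piece) (h : 'I_(size w)) : 'I_(size w).+1 :=
  lift ord0 h.

(* [o u] tells whether the string through u runs downwards there. *)
Definition orientation (w : seq piece) (o : dpoint w -> bool) : Prop :=
  (forall u v, descends through u v -> o u = o v) /\
  (forall u v, turns true u v -> o u = ~~ o v).

(* A sigma_i is right-handed iff its strands both run down or both run up. *)
Definition crossing_sign (w : seq piece) (o : dpoint w -> bool) (h : 'I_(size w)) : int :=
  match tnth (in_tuple w) h with
  | Cross i e => sgn e * sgn (o (above h, lft i) == o (above h, rgt i))
  | Hook _ => 0
  end.

Definition writhe (w : seq piece) (o : dpoint w -> bool) : int :=
  \sum_(h < size w) crossing_sign o h.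

Definition kauffman_poly (w : seq piece) (o : dpoint w -> bool) : Lambda :=
  (- aL ^- 3) ^ writhe o * link_bracket w.

(** * Reduced alternating and standard diagrams *)

(* One of the four ends of the piece h: [bot] for a lower end, [right] for a
   right one. *)
Record corner (w : seq piece) :=
  Corner { level : 'I_(size w); bot : bool; right : bool }.

Definition corner_piece (w : seq piece) (c : corner w) : piece :=
  tnth (in_tuple w) (level c).

Definition corner_point (w : seq piece) (c : corner w) : dpoint w :=
  (if bot c then below (level c) else above (level c),
   if right c then rgt (piece_pos (corner_piece c))
   else lft (piece_pos (corner_piece c))).

Definition is_over (w : seq piece) (c : corner w) : bool :=
  if corner_piece c is Cross _ e then (bot c != right c) == e else false.

(* c and c' are the two ends of an edge of q_4(w). *)
Definition same_edge (w : seq piece) (c c' : corner w) : Prop :=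
  [/\ c <> c', is_cross (corner_piece c), is_cross (corner_piece c') &
      connect (edge_rel false (w := w)) (corner_point c) (corner_point c')].

Definition alternating (w : seq piece) : Prop :=
  forall c c' : corner w, same_edge c c' -> is_over c != is_over c'.

(* A crossing of a tangle diagram can be removed by a Type I move iff an edge
   of the diagram has both its ends at that crossing. *)
Definition has_type_I_move (w : seq piece) : Prop :=
  exists c c' : corner w, same_edge c c' /\ level c = level c'.

Definition reduced_alternating (w : seq piece) : Prop :=
  alternating w /\ ~ has_type_I_move w.

Definition standard (w : seq piece) : Prop :=
  all (fun p => is_cross p && (piece_pos p != ord0)) w.

(** * Rational tangles *)

Section Geometry.
Variable R : realType.

Definition space3 : Type := (R * R * R)%type.

Definition pt (x y z : R) : space3 := (x, y, z).

Definition segment (P Q : space3) : set space3 :=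
  [set X | exists2 t : R, 0 <= t <= 1 &
     X = pt ((1 - t) * P.1.1 + t * Q.1.1)
            ((1 - t) * P.1.2 + t * Q.1.2)
            ((1 - t) * P.2 + t * Q.2)].

Definition broken (P M Q : space3) : set space3 := segment P M `|` segment M Q.

(* The diagram is drawn in the (x, y)-plane, its top endpoints being 1, ..., 4
   on the x-axis; it is viewed from z > 0. *)
Definition grid (h : nat) (x : 'I_4) : space3 := pt x.+1%:R (- h%:R) 0.

Definition piece_set (h : nat) (p : piece) : set space3 :=
  let i := piece_pos p in
  let mid (dy z : R) := pt (i.+1%:R + 2^-1) (- h%:R - dy) z in
  (\bigcup_(x in [set x : 'I_4 | ~~ touches i x]) segment (grid h x) (grid h.+1 x))
  `|` match p with
      | Cross _ e =>
          broken (grid h.+1 (lft i)) (mid 2^-1 (sgn e)%:~R) (grid h (rgt i)) `|`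
          broken (grid h (lft i)) (mid 2^-1 (- sgn e)%:~R) (grid h.+1 (rgt i))
      | Hook _ =>
          broken (grid h (lft i)) (mid 3^-1 0) (grid h (rgt i)) `|`
          broken (grid h.+1 (lft i)) (mid (2 / 3) 0) (grid h.+1 (rgt i))
      end.

Definition bottom_arc (h : nat) (i : 'I_3) : set space3 :=
  broken (grid h (lft i)) (pt (i.+1%:R + 2^-1) (- h%:R - 2^-1) 0) (grid h (rgt i)).

(* A tangle in space with diagram q_4(w). *)
Definition plat_tangle (w : seq piece) : set space3 :=
  (\bigcup_(h in [set h | (h < size w)%N]) piece_set h (nth (Hook ord0) w h))
  `|` bottom_arc (size w) (inord 0) `|` bottom_arc (size w) (inord 2).

(* A 3-ball below the plane y = 0 containing [plat_tangle w]. *)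
Definition plat_ball (w : seq piece) : set space3 :=
  [set P | [/\ 0 <= P.1.1 <= 5, - (size w).+1%:R <= P.1.2 <= 0 & -2 <= P.2 <= 2]].

(* [F b (s, t)] is the point of parameter t, at time s, of the arc b during an
   isotopy rel endpoints of both arcs from T (s = 0) into the boundary (s = 1).
   The isotopy is required to sweep two disjoint embedded discs: otherwise
   knotted arcs would qualify, a knot being shrunk to a point as s grows. *)
Definition rational_tangle (B T : set space3) : Prop :=
  exists F : bool -> R * R -> space3,
    [/\ forall b, {within `[0, 1]%classic `*` `[0, 1]%classic, continuous (F b)},
        T = \bigcup_(b in [set: bool]) [set F b (0, t) | t in `[0, 1]%classic],
        forall b s t, 0 <= s <= 1 -> 0 <= t <= 1 ->
          [/\ (t = 0) \/ (t = 1) -> F b (s, t) = F b (0, t),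
              (s = 1) \/ (t = 0) \/ (t = 1) -> (B `\` B^°) (F b (s, t)) &
              s < 1 -> 0 < t < 1 -> B^° (F b (s, t))] &
        forall b b' s s' t t',
          0 <= s <= 1 -> 0 <= s' <= 1 -> 0 <= t <= 1 -> 0 <= t' <= 1 ->
          F b (s, t) = F b' (s', t') ->
          [/\ b = b', t = t' & [\/ s = s', t = 0 | t = 1]]].

End Geometry.

Arguments plat_tangle R w : clear implicits.
Arguments plat_ball R w : clear implicits.

(** * The word w and the matrices A_2, A_3 *)

Definition sigma2 (e : bool) : piece := Cross (inord 1) e.
Definition sigma3 (e : bool) : piece := Cross (inord 2) e.

(* sigma_3^(-eps 1) sigma_2^(eps 2) ... sigma_3^(-eps (2n-1)) sigma_2^(eps (2n)) *)
Definition plat_word (n : nat) (eps : nat -> nat) : seq piece :=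
  flatten [seq nseq (eps j.*2.+1) (sigma3 false) ++ nseq (eps j.*2.+2) (sigma2 true)
          | j <- iota 0 n].

Definition mx22 (p q r s : Lambda) : 'M[Lambda]_2 :=
  \matrix_(i, j) (if i == 0 then (if j == 0 then p else q)
                  else (if j == 0 then r else s)).

Definition A2 : 'M[Lambda]_2 := mx22 (- aL ^- 3) aL^-1 0 aL.
Definition A3 : 'M[Lambda]_2 := (mx22 aL^-1 0 aL (- aL ^+ 3))^-1.

Definition plat_matrix (n : nat) (eps : nat -> nat) : 'M[Lambda]_2 :=
  \prod_(0 <= j < n) (A3 ^- eps j.*2.+1 * A2 ^+ eps j.*2.+2).

Definition col2 (x y : Lambda) : 'cV[Lambda]_2 :=
  \col_i (if i == 0 then x else y).

(* Main.v *)
Require Import Defs.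
From mathcomp Require Import all_boot all_order all_algebra.
From mathcomp Require Import reals.
Import GRing.Theory.
Local Open Scope ring_scope.

Set Implicit Arguments.
Unset Strict Implicit.
Unset Printing Implicit Defensive.

(** The bracket is computed letter by letter, from the bottom of the word to
    its top.  Let a crossingless diagram d be made of hooks U_2, U_3 stacked on
    the two bottom arcs.  It is T_0 or T_oo together with some circles, and its
    topmost hook decides which: U_2 gives T_0, and U_3 gives T_oo.  The empty
    word is T_oo, and its bottom arc on the right acts as the upper half of a
    topmost U_3.  Stack one more hook U_i on d.  If it is placed like the
    topmost hook of d, its lower half and the upper half of the latter bound a
    new circle; otherwise it joins the two arcs of d into one.  In both cases
    its upper half is an arc of the new diagram.  On the coefficients (f, g) of T_0 and T_oo, the hook U_2 thus
    acts by (f, g) |-> (k f + g, 0), and U_3 by (f, g) |-> (0, f + k g).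

    Smoothing a crossing then multiplies the vector (f, g) by
    a^e 1 + a^(-e) U_i.  With k = - a^2 - a^-2 this is A_2 for sigma_2, as
    a + a^-1 k = - a^-3, and the inverse of A_3 for the inverse of sigma_3, as
    a^-1 + a k = - a^3.  The empty word is T_oo, with vector (0, 1), so the
    product of these matrices applied to (0, 1) is the bracket of the tangle.

    The top arcs of the plat closure join the two arcs of T_0 into one circle
    and close those of T_oo into two.  As one circle has bracket 1, the bracket
    of the closure is f + k g, state by state.

    The combinatorial content lies in counting components of the graph that
    encodes a diagram.  They are counted by numbering them: 0 and 1 are the two
    arcs, and the numbers from 2 on are the circles.  [arc_labels_cons] updates
    the numbering when a hook is stacked on top, [circles_labels],
    [br_trivial_hook] and [link_labels] read the data off the numbering, and
    [diagram_value_hook] and [link_value] turn them into linear algebra. *)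

(** * Counting connected components by numbering them *)

Section Diagrams.
Local Open Scope nat_scope.

Lemma homo_connect (T T' : finType) (e : rel T) (e' : rel T') (h : T -> T') :
  (forall u v, e u v -> connect e' (h u) (h v)) ->
  forall u v, connect e u v -> connect e' (h u) (h v).
Proof.
move=> he u v /connectP[p]; elim: p u => [|x p IHp] u /= => [_ ->|] //.
by case/andP=> /he ux px /(IHp _ px); apply: connect_trans.
Qed.

Lemma connect_label (T : finType) (e : rel T) (L : T -> nat) :
  (forall u v, e u v -> L u = L v) -> forall u v, connect e u v -> L u = L v.
Proof.
move=> eL u v /connectP[p]; elim: p u => [|x p IHp] u /= => [_ ->|] //.
by case/andP=> /eL -> /IHp; apply.
Qed.

(** L numbers the components of e by 0, ..., N - 1. *)
Definition labels (T : finType) (e : rel T) (L : T -> nat) (N : nat) : Prop :=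
  [/\ connect_sym e, forall u v, connect e u v = (L u == L v),
      forall u, L u < N & forall l, l < N -> exists u, L u = l].

(** Each component has one root, so L runs once through m, ..., N - 1 on the
    roots in a. *)
Lemma n_comp_labels (T : finType) (e : rel T) (L : T -> nat) (N m : nat)
    (a : {pred T}) :
  labels e L N -> (forall u, (u \in a) = (m <= L u)) -> n_comp e a = N - m.
Proof.
move=> [symE eL ltLN surL] aE.
rewrite /n_comp_mem cardE -(size_map L) -(size_iota m (N - m)).
apply/perm_size/uniq_perm; rewrite ?iota_uniq //.
  rewrite map_inj_in_uniq ?enum_uniq // => u v.
  rewrite !mem_enum !inE => /andP[/eqP ru _] /andP[/eqP rv _] /eqP.
  by rewrite -eL => /(fingraph.rootP symE); rewrite ru rv.
move=> l; rewrite mem_iota; apply/mapP/andP => [[u]|[le_ml lt_l]].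
  rewrite mem_enum !inE aE => /andP[_ le_mu] ->; split=> //.
  by rewrite subnKC ?ltLN // (leq_trans le_mu (ltnW (ltLN u))).
have lt_lN : l < N.
  case: (leqP m N) => [le_mN | lt_Nm]; first by rewrite subnKC in lt_l.
  by move: lt_l; rewrite (eqnP (ltnW lt_Nm)) addn0 ltnNge le_ml.
have [u Lu] := surL _ lt_lN.
have Lr : L (fingraph.root e u) = l.
  by apply/eqP; rewrite -Lu -eL symE connect_root.
by exists (fingraph.root e u); rewrite // mem_enum !inE roots_root // aE Lr.
Qed.

(** If h joins a component numbered 0 to a component numbered 1, it carries all
    the points of these components into a single one.  This serves both for
    the lower half of a new hook and for the top arcs of the closure. *)
Lemma connect_merge (T T' : finType) (e' : rel T') (h : T -> T')
    (L : T -> nat) (p q : T) :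
  connect_sym e' -> (forall u v, L u = L v -> connect e' (h u) (h v)) ->
  connect e' (h p) (h q) -> L p + L q = 1 ->
  forall u v, L u <= 1 -> L v <= 1 -> connect e' (h u) (h v).
Proof.
move=> symE hL pq Lpq.
have to_p u : L u <= 1 -> connect e' (h u) (h p).
  move=> Lu; have [/hL//|neq] := eqVneq (L u) (L p).
  rewrite symE; apply: connect_trans pq _; apply: hL.
  by move: Lu neq Lpq; case: (L u) (L p) (L q) => [|[|?]] [|[|?]] [|[|?]].
by move=> u v /to_p up /to_p vp; apply: connect_trans up _; rewrite symE.
Qed.

(** * Adjacency in diagrams *)

Lemma touchesE i x : touches i x = (x == i :> nat) || (x == i.+1 :> nat).
Proof. by []. Qed.

Lemma swappedE i x y : swapped i x y =
  (x == i :> nat) && (y == i.+1 :> nat) || (x == i.+1 :> nat) && (y == i :> nat).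
Proof. by []. Qed.

Lemma swapped_sym i : symmetric (swapped i).
Proof. by move=> x y; rewrite /swapped orbC !(andbC (y == _)). Qed.

Lemma plat_arc_sym : symmetric plat_arc.
Proof. by move=> x y; rewrite /plat_arc !(swapped_sym _ x y). Qed.

Lemma turn_sym p : symmetric (turn p).
Proof. by case: p => //= i; apply: swapped_sym. Qed.

Lemma turns_sym closed w : symmetric (@turns closed w).
Proof.
move=> u v; rewrite /turns eq_sym; case: eqP => //= <-.
by rewrite !(turn_sym _ u.2) !(plat_arc_sym u.2).
Qed.

Lemma string_sym closed w : connect_sym (@string_rel closed w).
Proof.
apply: sym_connect_sym => u v.
by rewrite /string_rel /adjacent turns_sym orbCA.
Qed.

Lemma string_label closed w (L : dpoint w -> nat) :
  (forall u v, descends through u v -> L u = L v) ->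
  (forall u v, turns closed u v -> L u = L v) ->
  forall u v, @string_rel closed w u v -> L u = L v.
Proof. by move=> Ld Lt u v /or3P[/Ld|/Ld|/Lt]. Qed.

(** * Crossingless diagrams and their arcs *)

Definition hook_word (d : seq piece) : bool :=
  all (fun p => ~~ is_cross p && (piece_pos p != ord0)) d.

(** The empty word counts as a U_3, since its bottom arc on the right is placed
    like the upper half of that hook. *)
Definition top_hook (d : seq piece) : 'I_3 :=
  if d is p :: _ then piece_pos p else ord_max.

(** A hook creates a circle exactly when it faces a hook placed like itself. *)
Fixpoint circles (d : seq piece) : nat :=
  if d is p :: d' then circles d' + (piece_pos p == top_hook d') else 0.

Lemma top_hook_neq0 d : hook_word d -> top_hook d != ord0.
Proof. by case: d => // p d /andP[/andP[]]. Qed.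

(** The arc numbered 1 is the one that joins the two ends of the upper half of
    the topmost hook, the arc numbered 0 joins the two other top endpoints. *)
Definition arc_labels (d : seq piece) (L : dpoint d -> nat) : Prop :=
  labels (@string_rel false d) L (circles d).+2 /\
  forall x, L (top_point d x) = touches (top_hook d) x.

Lemma eq_dpoint w (u v : dpoint w) :
  u.1 = v.1 :> nat -> u.2 = v.2 :> nat -> u = v.
Proof. by case: u v => [h x] [k y] /= /val_inj-> /val_inj->. Qed.

Lemma arc_labels_nil : arc_labels (fun u : dpoint [::] => (1 < u.2) : nat).
Proof.
split; last by case=> [[|[|[|[|?]]]] ?].
have conn (u v : dpoint [::]) : (1 < u.2) = (1 < v.2) ->
    connect (@string_rel false [::]) u v.
  have [/eq_dpoint uv _|neq uv] := eqVneq (u.2 : nat) v.2.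
    by rewrite uv //; case: u v {uv} => [[[]] //= ? ?] [[[]]].
  apply: connect1; rewrite /string_rel /adjacent /turns /plat_arc !swappedE !inordK //.
  case: u v uv neq => [[[|?] //] ? x] [[[|?] //] ? y] uv neq; rewrite /=.
  by case: x y uv neq => [[|[|[|[|?]]]] ?] [[|[|[|[|?]]]] ?].
split.
- exact: string_sym.
- move=> u v; apply/idP/eqP => [|uv]; last first.
    by apply: conn; case: (1 < u.2) uv; case: (1 < v.2).
  move: u v; apply: (@connect_label _ _ (fun u : dpoint [::] => (1 < u.2) : nat)).
  apply: string_label.
    by move=> [[[|?] ?] ?] [[[|?] ?] ?] //= /andP[].
  move=> [[[|?] //] ? x] [[[|?] //] ? y] /andP[_].
  rewrite /plat_arc !swappedE !inordK //=.
  by case: x y => [[|[|[|[|?]]]] ?] [[|[|[|[|?]]]] ?].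
- by move=> u; case: (1 < u.2).
case=> [|[|]] // _; first by exists (ord0, ord0).
by exists (ord0, ord_max).
Qed.

(** * Stacking a hook on top of a diagram *)

Definition shift p (d : seq piece) (u : dpoint d) : dpoint (p :: d) :=
  (lift ord0 u.1, u.2).

Variant top_or_shift p d : dpoint (p :: d) -> Type :=
  | Top x : top_or_shift (top_point (p :: d) x)
  | Shift u : top_or_shift (shift p u).

Lemma top_or_shiftP p d (u : dpoint (p :: d)) : top_or_shift u.
Proof.
case: u => h x; case: (unliftP ord0 h) => [k|] ->; last exact: Top.
exact: (Shift p (k, x)).
Qed.

Lemma descends_shift thr p d (u v : dpoint d) :
  descends thr (shift p u) (shift p v) = descends thr u v.
Proof. by rewrite /descends /= /bump !leq0n !add1n. Qed.

(** Shifting creates no turn except for the lower half of a hook p, which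
    joins two points of the former top level. *)
Lemma turns_shift p d (u v : dpoint d) :
  turns false (shift p u) (shift p v) =
  turns false u v || [&& u.1 == ord0, v.1 == ord0 & turn p u.2 v.2].
Proof.
case: u v => [h x] [k y]; rewrite /turns /= -!val_eqE /= /bump !leq0n !add1n ltnS !eqSS.
case: eqP => [<-|neq]; last first.
  by rewrite /=; case: eqP => // h0; case: eqP => // k0; case: neq; rewrite h0 k0.
case: h => -[|h] hP /=; rewrite ?orbF //.
by case: (turn p x y); rewrite ?orbT ?orbF.
Qed.

Lemma descends_top_shift p d x (u : dpoint d) :
  descends through (top_point (p :: d) x) (shift p u) =
  (u.1 == ord0) && through p x u.2.
Proof. by rewrite /descends /= /bump leq0n add1n. Qed.

Lemma turns_top p d x y :
  turns false (top_point (p :: d) x) (top_point (p :: d) y) = turn p x y.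
Proof. by rewrite /turns eqxx /= orbF. Qed.

Lemma touches_turn i : touches i (lft i) && touches i (rgt i).
Proof. by rewrite /touches !eqxx orbT. Qed.

(** Of the two ends of a U_2, exactly one belongs to a U_3, and conversely;
    this fails for U_1 and U_3. *)
Lemma touches_end i t :
  i != ord0 -> t != ord0 -> i != t -> touches t (lft i) + touches t (rgt i) = 1.
Proof.
rewrite !touchesE; case: i => [[|[|[|?]]] ?] // _.
all: by case: t => [[|[|[|?]]] ?].
Qed.

Lemma touches_ord0 i : i != ord0 -> touches i ord0 = false.
Proof. by rewrite touchesE; case: i => [[|[|[|?]]] ?]. Qed.

(** The upper half of the new hook takes the number 1.  The arc that had it
    either becomes a circle, with the first free number, or merges with the
    arc 0. *)
Definition relabel (c : nat) (loop : bool) (l : nat) : nat :=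
  if l == 1 then (if loop then c.+2 else 0) else l.

Definition cons_label p d (L : dpoint d -> nat) (u : dpoint (p :: d)) : nat :=
  if unlift ord0 u.1 is Some k
  then relabel (circles d) (piece_pos p == top_hook d) (L (k, u.2))
  else touches (piece_pos p) u.2.

(** A new hook joins two top endpoints of d.  Both lie on the arc 1 if the hook
    is placed like the topmost hook of d, and they lie on different arcs
    otherwise; in both cases [relabel] performs the resulting identification,
    and no other component changes. *)
Lemma arc_labels_cons i d (L : dpoint d -> nat) :
  i != ord0 -> top_hook d != ord0 -> arc_labels L ->
  arc_labels (@cons_label (Hook i) d L).
Proof.
move=> i0 t0 [[symE eL ltL surL] Ltop].
pose t := top_hook d; pose c := circles d; pose phi := relabel c (i == t).
set L' := cons_label _; set e' := @string_rel false (Hook i :: d).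
have L'top x : L' (top_point _ x) = touches i x.
  by rewrite /L' /cons_label unlift_none.
have L'shift u : L' (shift _ u) = phi (L u).
  by rewrite /L' /cons_label liftK; case: u.
have symE' : connect_sym e' by apply: string_sym.
have phi_top x : ~~ touches i x -> phi (touches t x) = 0.
  rewrite /phi /relabel; case: (i =P t) => [<-|_] /negPf; first by move->.
  by case: (touches t x).
have phi_turn x y : swapped i x y -> phi (touches t x) = phi (touches t y).
  rewrite /phi /relabel; case: (i =P t) => [<-|_].
    have /andP[il ir] := touches_turn i.
    by rewrite /swapped; case/orP=> /andP[/eqP-> /eqP->]; rewrite il ir.
  by case: (touches t x); case: (touches t y).
have eL' u v : e' u v -> L' u = L' v.
  apply: (@string_label false _ L') => {}u {}v.
    case: (top_or_shiftP u) => [x|{}u]; case: (top_or_shiftP v) => [y|{}v] //.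
      rewrite descends_top_shift => /andP[/eqP v0].
      rewrite /through /crossing orbF => /andP[/eqP-> nty].
      rewrite L'top L'shift (negPf nty).
      by case: v v0 nty => k z /= -> nty; rewrite -/(top_point d z) Ltop phi_top.
    rewrite descends_shift !L'shift => duv; congr phi; apply/eqP.
    by rewrite -eL connect1 // /string_rel /adjacent duv.
  case: (top_or_shiftP u) => [x|{}u]; case: (top_or_shiftP v) => [y|{}v] //.
    rewrite turns_top !L'top => /orP[] /andP[/eqP-> /eqP->];
    by have /andP[-> ->] := touches_turn i.
  rewrite turns_shift !L'shift => /orP[tuv|].
    congr phi; apply/eqP.
    by rewrite -eL connect1 // /string_rel /adjacent tuv !orbT.
  case: u v => [h x] [k y] /= /and3P[/eqP-> /eqP-> /phi_turn].
  by rewrite -!/(top_point d _) !Ltop.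
have shiftE u v : L u = L v -> connect e' (shift _ u) (shift _ v).
  move/eqP; rewrite -eL; apply: homo_connect => {}u {}v uv.
  apply: connect1; rewrite /e' /string_rel /adjacent !descends_shift turns_shift.
  by case/or3P: uv => ->; rewrite ?orbT.
have capE : connect e' (shift (Hook i) (top_point d (lft i)))
                       (shift (Hook i) (top_point d (rgt i))).
  apply: connect1; rewrite /e' /string_rel /adjacent turns_shift /=.
  by rewrite /swapped !eqxx !orbT.
have phi1 l : phi l != 1.
  by rewrite /phi /relabel; case: (l =P 1) => [_|/eqP//]; case: ifP.
(* The relabelled points of d are connected as their new numbers say: only the
   arcs 0 and 1 can have been merged, and then the new hook connects them. *)
have phiE u v : phi (L u) = phi (L v) -> connect e' (shift _ u) (shift _ v).
  move=> phi_uv; have [/shiftE//|neq] := eqVneq (L u) (L v).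
  move: phi_uv (ltL u) (ltL v); rewrite /phi /relabel -/c.
  have [_|it] := eqVneq i t => /=.
    case: ifP => [/eqP u1|_]; case: ifP => [/eqP v1|_].
    - by rewrite u1 v1 in neq.
    - by move=> <- _; rewrite ltnn.
    - by move=> ->; rewrite ltnn.
    by move/eqP; rewrite (negPf neq).
  have le1 l m : (if l == 1 then 0 else l) = (if m == 1 then 0 else m) ->
      l != m -> l <= 1.
    by case: l m => [|[|l]] [|[|m]] //= ->; rewrite eqxx.
  move=> uv _ _.
  apply: (connect_merge symE' shiftE capE _ (le1 _ _ uv neq)).
    by rewrite !Ltop; apply: touches_end.
  by apply: le1 (esym uv) _; rewrite eq_sym.
(* Every point is on the upper half of the new hook or connected to d. *)
have reach u : L' u = 1 /\ connect e' u (top_point _ (lft i)) \/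
    exists2 v, L' u = phi (L v) & connect e' u (shift _ v).
  case: (top_or_shiftP u) => [x|v]; last by right; exists v.
  case tx: (touches i x); [left | right].
    split; first by rewrite L'top tx.
    have [-> //|xl] := eqVneq x (lft i).
    apply: connect1; rewrite /e' /string_rel /adjacent turns_top /=.
    by move: tx; rewrite /touches /swapped (negPf xl) /= => ->; rewrite eqxx ?orbT.
  exists (top_point d x); first by rewrite L'top Ltop phi_top tx.
  apply: connect1; rewrite /e' /string_rel /adjacent descends_top_shift /=.
  by rewrite /through /vertical eqxx tx.
split; last by move=> x; rewrite L'top.
split=> //.
- move=> u v; apply/idP/eqP => [|uv]; first exact: connect_label.
  case: (reach u) (reach v) uv => [[-> ul]|[x -> ux]] [[-> vl]|[y -> vy]].
  + by rewrite symE' in vl => _; apply: connect_trans ul vl.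
  + by move/esym/eqP; rewrite (negPf (phi1 _)).
  + by move/eqP; rewrite (negPf (phi1 _)).
  by rewrite symE' in vy => /phiE xy; apply: connect_trans (connect_trans ux xy) vy.
- move=> u; rewrite /= -/t -/c addnC.
  case: (top_or_shiftP u) => [x|v]; first by rewrite L'top; case: touches.
  rewrite L'shift /phi /relabel; case: ifP => _; last first.
    by apply: leq_trans (ltL v) _; rewrite !ltnS leq_addl.
  by case: eqP.
case=> [_|[_|l]].
- by exists (top_point _ ord0); rewrite L'top touches_ord0.
- by exists (top_point _ (lft i)); rewrite L'top; have /andP[->] := touches_turn i.
rewrite /= -/t -/c !ltnS addnC.
have [lt_lc _|le_cl] := ltnP l c.
  by have [u Lu] := surL l.+2 lt_lc; exists (shift (Hook i) u); rewrite L'shift Lu.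
(* The largest number is new only if a circle was closed: the former arc 1. *)
case: (i =P t) => [it|_] lt_l; last by rewrite add0n ltnNge le_cl in lt_l.
have [u Lu] := surL 1 isT; exists (shift (Hook i) u).
rewrite L'shift Lu /phi /relabel it !eqxx; apply/eqP.
by rewrite !eqSS eqn_leq le_cl -ltnS.
Qed.

Lemma arc_labels_exist d :
  hook_word d -> exists L : dpoint d -> nat, arc_labels L.
Proof.
elim: d => [_|p d IHd].
  by exists (fun u : dpoint [::] => (1 < u.2) : nat); apply: arc_labels_nil.
move=> /= /andP[/andP[]]; case: p => //= i _ i0 hd.
have [L Ld] := IHd hd; exists (@cons_label (Hook i) d L).
exact: arc_labels_cons (top_hook_neq0 hd) Ld.
Qed.

(** * Reading a diagram off the numbering *)

Section Counts.
Variables (d : seq piece) (L : dpoint d -> nat).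
Hypotheses (hd : hook_word d) (Ld : arc_labels L).

Lemma joins_labels x y :
  joins d x y = (touches (top_hook d) (inord x) == touches (top_hook d) (inord y)).
Proof.
have [[_ eL _ _] Ltop] := Ld.
by rewrite /joins eL !Ltop; do 2!case: touches.
Qed.

(** The circles are the components numbered 2 or more: both arcs reach the top. *)
Lemma circles_labels : tangle_circles d = circles d.
Proof.
have [labL Ltop] := Ld; have [_ eL _ _] := labL.
rewrite /tangle_circles (n_comp_labels (m := 2) labL) ?subn2 // => u.
rewrite inE; apply/forallP/idP => [nu | lt1u x].
  have:= nu (lft (top_hook d)); have:= nu ord0.
  rewrite !eL !Ltop touches_ord0 ?top_hook_neq0 //.
  by have /andP[-> _] := touches_turn (top_hook d); case: (L u) => [|[|]].
by rewrite eL Ltop neq_ltn; case: touches; rewrite ?lt1u ?(ltnW lt1u).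
Qed.

(** If the topmost hook is U_2, each top arc joins the arc 0 to the arc 1, and
    the predecessor function numbers the components of the closure.  If it is
    U_3, each top arc joins the ends of one arc, and the numbering is
    unchanged. *)
Lemma link_labels :
  link_components d = circles d + (if top_hook d == 1 :> nat then 1 else 2).
Proof.
have [labL Ltop] := Ld; have [_ eL ltL surL] := labL.
pose t := top_hook d; set e' := @string_rel true d.
have symE' : connect_sym e' by apply: string_sym.
have t0 : t != ord0 by apply: top_hook_neq0.
have openE u v : L u = L v -> connect e' u v.
  move/eqP; rewrite -eL; apply: connect_sub => {}u {}v uv; apply: connect1.
  case/or3P: uv => [duv|duv|]; rewrite /e' /string_rel /adjacent ?duv ?orbT //.
  rewrite /turns andFb orbF => /andP[-> /or3P[]->]; by rewrite ?orbT.
have arcE x y : plat_arc x y -> connect e' (top_point d x) (top_point d y).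
  move=> xy; apply: connect1.
  by rewrite /e' /string_rel /adjacent /turns /= xy ?eqxx !orbT.
have closedE (f : nat -> nat) :
    (forall x y, plat_arc x y -> f (touches t x) = f (touches t y)) ->
    forall u v, e' u v -> f (L u) = f (L v).
  move=> f_arc; apply: string_label => u v.
    by move=> uv; congr f; apply/eqP; rewrite -eL connect1 // /string_rel /adjacent uv.
  case/andP=> uv; case/or4P=> [tuv|tuv|tuv|].
  1-3: by congr f; apply/eqP; rewrite -eL connect1 // /string_rel /adjacent
         /turns uv tuv ?orbT.
  case: u v uv => [h x] [k y] /= /eqP<- /andP[/eqP h0].
  have -> : h = ord0 by apply: val_inj.
  by rewrite -!/(top_point d _) !Ltop; apply: f_arc.
have arcP x y : plat_arc x y = (x./2 == y./2) && (x != y).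
  rewrite /plat_arc !swappedE !inordK //.
  by case: x y => [[|[|[|[|?]]]] ?] [[|[|[|[|?]]]] ?].
have le1 l m : l.-1 = m.-1 -> l != m -> l <= 1.
  by case: l m => [|[|l]] [|[|m]] //= [->]; rewrite eqxx.
case: ifP => [t1|tn1].
  have labL' : labels e' (fun u => (L u).-1) (circles d).+1.
    split=> //.
    - move=> u v; apply/idP/eqP => [|uv].
        apply: (connect_label (L := fun u => (L u).-1)) => {}u {}v.
        by apply: closedE => x y _; case: (touches t x); case: (touches t y).
      have [/openE//|neq] := eqVneq (L u) (L v).
      have top01 : connect e' (top_point d ord0) (top_point d (inord 1)).
        by apply: arcE; rewrite arcP -val_eqE /= inordK.
      apply: (connect_merge (h := id) symE' openE top01).
      + by rewrite !Ltop !touchesE inordK // (eqP t1).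
      + exact: le1 uv neq.
      by apply: le1 (esym uv) _; rewrite eq_sym.
    - by move=> u; have:= ltL u; case: (L u).
    by move=> l lt_l; have [u Lu] := surL l.+1 lt_l; exists u; rewrite Lu.
  by rewrite /link_components (n_comp_labels (m := 0) labL') // subn0 addn1.
have labL' : labels e' L (circles d).+2.
  split=> // u v; apply/idP/eqP => [|/openE //].
  apply: connect_label => {}u {}v; apply: (closedE id) => x y.
  rewrite arcP; move: t0 tn1; rewrite -/t !touchesE.
  by case: (t) => [[|[|[|?]]] ?] // _ _; case: x y => [[|[|[|[|?]]]] ?] [[|[|[|[|?]]]] ?].
by rewrite /link_components (n_comp_labels (m := 0) labL') // subn0 addn2.
Qed.

End Counts.

Lemma br_trivial_hook d : hook_word d ->
  br_trivial d = if top_hook d == 1 :> nat then br_T0 else br_Too.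
Proof.
move=> hd; have [L Ld] := arc_labels_exist hd.
rewrite /br_trivial !(joins_labels Ld) !touchesE !inordK //.
by move: (top_hook_neq0 hd); case: (top_hook d) => [[|[|[|?]]] ?].
Qed.

End Diagrams.

(** * The vector of a crossingless diagram *)

Lemma aL_unit : aL \is a GRing.unit.
Proof.
have inv_laurent : (FracField.tofrac ('X : {poly int}))^-1 \in laurent.
  by apply/boolp.asboolP; exists 1, 1%N; rewrite expr1 rmorph1 mul1r.
apply/boolp.asboolP; exists (MkLambda inv_laurent); apply/eqP/val_inj => /=.
by rewrite mulVf // -[X in X != 0]expr1 tofracX_neq0.
Qed.

Lemma mulmx_col2 p q r s x y :
  mx22 p q r s *m col2 x y = col2 (p * x + q * y) (r * x + s * y).
Proof.
by apply/colP => i; rewrite !mxE big_ord_recl big_ord1 !mxE /=; case: (i == 0).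
Qed.

Lemma scale_col2 c x y : c *: col2 x y = col2 (c * x) (c * y).
Proof. by apply/colP => i; rewrite !mxE; case: ifP. Qed.

Lemma br_T0E : br_T0 = col2 1 0.
Proof. by apply/colP => i; rewrite !mxE andbT; case: (i == 0). Qed.

Lemma br_TooE : br_Too = col2 0 1.
Proof. by apply/colP => -[[|[|?]] ?]; rewrite !mxE. Qed.

Definition diagram_value (d : seq piece) : 'cV[Lambda]_2 :=
  kL ^+ tangle_circles d *: br_trivial d.

(** The action of a hook stacked on top, in the basis (T_0, T_oo). *)
Definition hook_mx (i : 'I_3) : 'M[Lambda]_2 :=
  if i == 1 :> nat then mx22 kL 1 0 0 else mx22 0 0 1 kL.

Lemma diagram_value_hook i d : i != ord0 -> hook_word d ->
  diagram_value (Hook i :: d) = hook_mx i *m diagram_value d.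
Proof.
move=> i0 hd; have hid : hook_word (Hook i :: d) by rewrite /= i0.
have [L Ld] := arc_labels_exist hd; have [L' Ld'] := arc_labels_exist hid.
rewrite /diagram_value (circles_labels hd Ld) (circles_labels hid Ld') /=.
rewrite !br_trivial_hook // -scalemxAr exprD -scalerA; congr (_ *: _).
rewrite br_T0E br_TooE /hook_mx -val_eqE /=.
move: i0 (top_hook_neq0 hd); case: i {hid L' Ld'} => [[|[|[|?]]] ?] //= _;
  case: (top_hook d) => [[|[|[|?]]] ?] //= _;
  rewrite mulmx_col2 ?expr1 ?scale_col2 ?scale1r;
  by rewrite !(mulr0, mulr1, mul0r) ?addr0 ?add0r.
Qed.

(** Closing T_0 gives one circle and closing T_oo two, with brackets 1 and k. *)
Definition closure_value (v : 'cV[Lambda]_2) : Lambda := v 0 0 + kL * v 1 0.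

Lemma link_value d : hook_word d ->
  kL ^+ (link_components d).-1 = closure_value (diagram_value d).
Proof.
move=> hd; have [L Ld] := arc_labels_exist hd.
rewrite /diagram_value (circles_labels hd Ld) (link_labels hd Ld) br_trivial_hook //.
rewrite /closure_value; case: ifP => _; rewrite !mxE /=.
  by rewrite addn1 mulr1 !mulr0 addr0.
by rewrite addn2 mulr1 mulr0 add0r -exprS.
Qed.

(** * Brackets of standard words *)

Lemma states_hook_word w :
  standard w -> all (fun cd => hook_word cd.2) (states w).
Proof.
rewrite /standard; elim: w => //= p w IHw /andP[/andP[]].
case: p => //= i e _ i0 /IHw hw.
rewrite all_cat !all_map; apply/andP; split=> //.
by rewrite (eq_all (a2 := fun cd => hook_word cd.2)) // => cd /=; rewrite i0.
Qed.

Lemma eq_sum_all (V : nmodType) (T : Type) (P : pred T) (s : seq T) (F G : T -> V) :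
  all P s -> (forall x, P x -> F x = G x) -> \sum_(x <- s) F x = \sum_(x <- s) G x.
Proof.
move=> Ps FG; elim: s Ps => [|x s IHs] /=; first by rewrite !big_nil.
by case/andP=> /FG Fx /IHs sE; rewrite !big_cons Fx sE.
Qed.

Lemma link_bracketE w : standard w ->
  link_bracket w = closure_value (tangle_bracket w).
Proof.
move=> hw; rewrite /link_bracket /closure_value /tangle_bracket !summxE mulr_sumr.
rewrite -big_split /=; apply: eq_sum_all (states_hook_word hw) _ => cd hd.
rewrite link_value // /closure_value -scalerA !mxE mulrDr.
by congr (_ + _); rewrite mulrCA.
Qed.

Definition letter_mx (p : piece) : 'M[Lambda]_2 :=
  match p with
  | Cross i e => (aL ^ sgn e)%:M + aL ^ (- sgn e) *: hook_mx i
  | Hook i => hook_mx i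
  end.

(** Every state of p :: w comes from a state of w by leaving the two strings of
    p vertical or by stacking a hook on top. *)
Lemma tangle_bracket_cons p w : standard (p :: w) ->
  tangle_bracket (p :: w) = letter_mx p *m tangle_bracket w.
Proof.
move=> /andP[/andP[]]; case: p => //= i e _ i0 /states_hook_word hw.
rewrite /tangle_bracket /= big_cat !big_map /= mulmxDl mul_scalar_mx -scalemxAl.
rewrite mulmx_sumr !scaler_sumr; congr (_ + _).
  by apply: eq_bigr => cd _; rewrite scalerA mulrA.
apply: eq_sum_all hw _ => cd hd.
by rewrite -!scalerA -!/(diagram_value _) diagram_value_hook // scalemxAr.
Qed.

Lemma tangle_bracketE w : standard w ->
  tangle_bracket w = (\prod_(p <- w) letter_mx p) *m col2 0 1.
Proof.
elim: w => [_|p w IHw pw].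
  rewrite /tangle_bracket big_seq1 big_nil mul1r mul1mx.
  have nilL := arc_labels_nil.
  by rewrite (circles_labels _ nilL) // br_trivial_hook // expr0 scale1r br_TooE.
rewrite tangle_bracket_cons // IHw; last by case/andP: pw.
by rewrite big_cons mulmxA.
Qed.

(** * The matrices of the letters of the plat word *)

Lemma mx22_lin x c p q r s :
  x%:M + c *: mx22 p q r s = mx22 (x + c * p) (c * q) (c * r) (x + c * s).
Proof.
by apply/matrixP => -[[|[|?]] ?] // [[|[|?]] ?] //;
  rewrite !mxE /= ?mulr0n ?mulr1n ?add0r.
Qed.

Lemma letter_mx_sigma2 : letter_mx (sigma2 true) = A2.
Proof.
rewrite /= /hook_mx inordK //= expr1z exprN1 mx22_lin !(mulr0, mulr1, addr0).
congr mx22; rewrite /kL mulrBr mulrN -!exprVn -exprS expr2 mulKr ?aL_unit //.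
by rewrite addrA subrr add0r.
Qed.

Lemma letter_mx_sigma3 : letter_mx (sigma3 false) = A3^-1.
Proof.
rewrite /A3 invrK /= /hook_mx inordK //= expr1z exprN1 mx22_lin.
rewrite !(mulr0, mulr1, addr0).
congr mx22; rewrite /kL mulrBr mulrN -exprS.
by rewrite -exprVn (expr2 aL^-1) mulVKr ?aL_unit // addrC subrK.
Qed.

Lemma plat_word_matrix n eps :
  \prod_(p <- plat_word n eps) letter_mx p = plat_matrix n eps.
Proof.
rewrite /plat_word big_flatten big_map /plat_matrix /index_iota subn0.
apply: eq_bigr => j _; rewrite big_cat !big_nseq !iter_mulr_1.
by rewrite letter_mx_sigma2 letter_mx_sigma3 exprVn.
Qed.

Theorem theorem2p4 (R : realType) (n : nat) (eps : nat -> nat)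
    (n_ge1 : (1 <= n)%N)
    (eps_gt0 : forall j : nat, (2 <= j <= 2 * n)%N -> (0 < eps j)%N) :
  let w := plat_word n eps in
  rational_tangle (plat_ball R w) (plat_tangle R w) ->
  reduced_alternating w ->
  standard w ->
  exists f g : Lambda,
    [/\ tangle_bracket w = f *: br_T0 + g *: br_Too,
        col2 f g = plat_matrix n eps *m col2 0 1 &
        is_knot w ->
          link_bracket w = f - (aL ^+ 2 + aL ^- 2) * g /\
          (forall o : dpoint w -> bool, orientation o ->
             kauffman_poly o =
               (- aL ^- 3) ^ writhe o * (f - (aL ^+ 2 + aL ^- 2) * g))].
Proof.
move=> w _ _ stdw; set f := tangle_bracket w 0 0; set g := tangle_bracket w 1 0.
have Tfg : tangle_bracket w = col2 f g.
  apply/colP => i; rewrite mxE; case: ifP => i0; congr (tangle_bracket w _ _).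
    exact/eqP.
  by apply/eqP; move: i0; case: i => [[|[|?]] ?].
have Kfg : link_bracket w = f - (aL ^+ 2 + aL ^- 2) * g.
  by rewrite link_bracketE // /closure_value -/f -/g /kL -opprD mulNr.
exists f, g; split=> [||_].
- by rewrite Tfg br_T0E br_TooE; apply/colP => i; rewrite !mxE; case: ifP => _;
  rewrite !(mulr0, mulr1, addr0, add0r).
- by rewrite -Tfg tangle_bracketE // plat_word_matrix.
by split=> // o _; rewrite /kauffman_poly Kfg.
Qed.
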